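(* Let $L,a,b,c>0$ be constants and let $p\in L^1[0,L]$ satisfy $$\frac{2a^2M^2}{bL^2N}>\|p\|_1 .$$ Let $w\in W^{4,1}[0,L]$ be a solution of the boundary value problem $$w''''(x)-\Big(a+b\int_0^Lw(t)\,dt\Big)w''(x)+c\int_0^Lw(t)\,dt=p(x),\quad x\in(0,L),\qquad w(0)=w(L)=w''(0)=w''(L)=0.$$ If $\int_0^Lw(x)\,dx\ge0$, then $$\Big|\int_0^Lw(x)\,dx\Big|\le\frac{L^2}{8aM}\,\|p\|_1,\qquad\|w''\|_1\le\frac{N}{aM}\,\|p\|_1 .$$ Moreover, the function $\varphi=p+b\big(\int_0^Lw(x)\,dx\big)w''$ satisfies $$\|\varphi\|_1\le\tfrac54\|p\|_1 .$$
   Context: $\|\cdot\|_1$ is the norm of $L^1[0,L]$. The differential equation is understood almost everywhere. Notation: $$M=1+c\Big(\frac{L^3}{12a}-\frac{L}{a^2}+\frac{2}{a^{5/2}}\tanh\frac{\sqrt aL}{2}\Big),\qquad N=1+c\Big(\frac{5L^3}{24a}-\frac{L}{a^2}+\frac{1}{a^{5/2}}\big(2-\tfrac{aL^2}{4}\big)\tanh\frac{\sqrt aL}{2}\Big).$$ *)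

(* Defs.v *)
From mathcomp Require Import all_boot all_order all_algebra.
From mathcomp Require Import all_classical all_reals all_analysis.

Set Implicit Arguments.
Unset Strict Implicit.
Unset Printing Implicit Defensive.

Import Order.TTheory GRing.Theory Num.Theory.
Import numFieldNormedType.Exports.

Local Open Scope classical_set_scope.
Local Open Scope ring_scope.

Definition tanh (R : realType) (x : R) : R :=
  (expR x - expR (- x)) / (expR x + expR (- x)).

Definition abs_continuous_on (R : realType) (D : set R) (f : R -> R) : Prop :=
  forall e : R, 0 < e -> exists2 d : R, 0 < d &
    forall (n : nat) (x y : 'I_n -> R),
      (forall i, [/\ D (x i), D (y i) & x i <= y i]) ->
      trivIset [set: 'I_n] (fun i => `]x i, y i[%classic) ->
      \sum_i (y i - x i) < d ->
      \sum_i `|f (y i) - f (x i)| < e.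

Definition in_L1 (R : realType) (L : R) (f : R -> R) : Prop :=
  (@lebesgue_measure R).-integrable `[0, L] (EFin \o f).

(* An element of W^{4,1}[0, L] is represented by a total function of which only
   the values on [0, L] matter.  Its derivatives are therefore taken in the
   open interval only; w''' being absolutely continuous there, w', w'' and w'''
   have limits at 0 and L, which are their boundary values; the values of derive1n k w
   at 0 and L depend on the extension of w and only occur under integrals.  That w'''' exists
   almost everywhere and is integrable in fact follows from the absolute
   continuity of w'''. *)
Definition in_W41 (R : realType) (L : R) (w : R -> R) : Prop :=
  [/\ {within `[0, L], continuous w},
      forall (k : nat) (x : R), (k < 3)%N -> x \in `]0, L[ ->
        derivable (derive1n k w) x 1,
      abs_continuous_on `]0, L[%classic (derive1n 3 w),
      {ae (@lebesgue_measure R), forall x : R, x \in `]0, L[ ->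
        derivable (derive1n 3 w) x 1}
    & in_L1 L (derive1n 4 w)].

Definition integral0L (R : realType) (L : R) (f : R -> R) : R :=
  \int[@lebesgue_measure R]_(x in `[0, L]) f x.

(* Meaningful only if f is integrable on [0, L]: the integral is turned into a
   real number by sending infinity to 0. *)
Definition norm1 (R : realType) (L : R) (f : R -> R) : R :=
  \int[@lebesgue_measure R]_(x in `[0, L]) `|f x|.

Definition is_solution (R : realType) (L a b c : R) (p w : R -> R) : Prop :=
  [/\ {ae (@lebesgue_measure R), forall x : R, x \in `]0, L[ ->
        derive1n 4 w x - (a + b * integral0L L w) * derive1n 2 w x
        + c * integral0L L w = p x},
      w 0 = 0, w L = 0,
      derive1n 2 w x @[x --> 0^'+] --> (0 : R)
    & derive1n 2 w x @[x --> L^'-] --> (0 : R)].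

Definition constM (R : realType) (L a c : R) : R :=
  1 + c * (L ^+ 3 / (12 * a) - L / a ^+ 2
           + 2 / (a `^ (5 / 2)) * tanh (Num.sqrt a * L / 2)).

Definition constN (R : realType) (L a c : R) : R :=
  1 + c * (5 * L ^+ 3 / (24 * a) - L / a ^+ 2
           + 1 / (a `^ (5 / 2)) * (2 - a * L ^+ 2 / 4)
             * tanh (Num.sqrt a * L / 2)).

(* Main.v *)
Require Import Defs.
From mathcomp Require Import all_boot all_order all_algebra.
From mathcomp Require Import all_classical all_reals all_analysis.
From mathcomp Require Import measurable_realfun lra ring.

(* Write S for the integral of w, k = a + b S >= a and u = w'', so that
   - u'' + k u = c S - p with u vanishing at 0 and L.  Let y_k be the torsion
   function, - y_k'' + k y_k = 1 with y_k(0) = y_k(L) = 0; it is concave, hence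
   0 <= y_k, and q - y_k is concave for q(x) = x (L - x) / 2, hence y_k <= q.
   With Z the integral of y_a one finds a M = a + c (L^3/12 - Z) and
   N = M + c L^2 Z / 8.
   Since w vanishes at the ends, S = - int q u, and theta = (q - y_k) / k solves
   - theta'' + k theta = q, so integrating by parts S = int theta (p - c S).
   As 0 <= theta <= L^2 / (8 k) and int y_k <= int y_a, this is the first bound.
   Testing the equation for u with y_k times a smoothed sign of u gives
   |u|_1 <= int y_k |c S - p| <= |p|_1 / a + c S Z, which is the second bound; the
   third one is the triangle inequality and the smallness of p.
   Since u' is only absolutely continuous, these integrations by parts rest on the
   fundamental theorem of calculus for absolutely continuous functions. *)

Set Implicit Arguments.
Unset Strict Implicit.
Unset Printing Implicit Defensive.

Import Order.TTheory GRing.Theory Num.Theory.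
Import numFieldNormedType.Exports.

Local Open Scope classical_set_scope.
Local Open Scope ring_scope.

(** * Absolutely continuous functions *)

(** The supremum of the points of [a, b] where [P] holds is reached by the backward half of the
    step; the forward half then goes beyond it unless it is [b]. *)
Lemma real_induction (R : realType) (P : R -> Prop) (a b : R) :
  a <= b -> P a ->
  (forall t, a <= t <= b -> exists2 d, 0 < d &
    forall s r, a <= s <= t -> t <= r <= b -> t - s < d -> r - t < d ->
      (P s -> P t) /\ (P t -> P r)) ->
  P b.
Proof.
move=> ab Pa step.
pose S := [set t | a <= t <= b /\ P t].
have Sa : S a by split => //; rewrite lexx.
have bS : has_sup S.
  by split; [exists a | exists b => t [/andP[_ tb] _]].
pose t := sup S.
have tab : a <= t <= b.
  apply/andP; split; first exact: (ub_le_sup bS.2 Sa).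
  by apply: ge_sup; [exists a | move=> x [/andP[_ ?] _]].
have [d d0 std] := step t tab.
have [s [sab Ps] sd] := sup_adherent d0 bS.
have st : s <= t by apply: (ub_le_sup bS.2).
have Pt : P t.
  apply: (std s t _ _ _ _).1 => //; rewrite ?subrr//.
  - by rewrite st; case/andP: sab => ->.
  - by rewrite lexx; case/andP: tab => _ ->.
  - by rewrite -/t in sd; lra.
have [tb|tb] := leP b t.
  by have -> : b = t by apply/eqP; rewrite eq_le tb; case/andP: tab.
pose r := Num.min b (t + d / 2).
have rb : r <= b by rewrite ge_min lexx.
have tr : t < r by rewrite lt_min tb; lra.
have rd : r <= t + d / 2 by rewrite ge_min lexx orbT.
have Sr : S r.
  split; first by rewrite rb andbT; case/andP: tab => *; lra.
  apply: (std t r _ _ _ _).2 => //; rewrite ?subrr//.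
  - by case/andP: tab => -> _ /=.
  - by rewrite ltW.
  - by lra.
by have := ub_le_sup bS.2 Sr; rewrite -/t leNgt tr.
Qed.

(** Listing the intervals from right to left lets a family found from left to right grow by consing;
    shared endpoints do no harm because the intervals are open. *)
Lemma abs_continuous_on_seq (R : realType) (D : set R) (f : R -> R) (e : R) :
  abs_continuous_on D f -> 0 < e -> exists2 d : R, 0 < d &
    forall l : seq (R * R),
      (forall u, u \in l -> [/\ D u.1, D u.2 & u.1 <= u.2]) ->
      pairwise (fun u v => v.2 <= u.1) l ->
      \sum_(u <- l) (u.2 - u.1) < d ->
      \sum_(u <- l) `|f u.2 - f u.1| < e.
Proof.
move=> acf e0; have [d d0 fd] := acf e e0; exists d => // l lD lpw.
rewrite !(big_nth (0, 0)) !big_mkord => ld.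
apply: (fd (size l) (fun i => (nth (0, 0) l i).1)
                    (fun i => (nth (0, 0) l i).2)) => //.
  by move=> i; apply/lD/mem_nth.
move=> i j _ _ [z [/= zi zj]].
apply: contrapT => /eqP ij; have {ij} : (i < j)%N || (j < i)%N.
  by rewrite -neq_ltn.
rewrite !in_itv/= in zi zj; move/andP: zi => [zi1 zi2]; move/andP: zj => [zj1 zj2].
have lt0 (k1 k2 : 'I_(size l)) : (k1 < k2)%N ->
    (nth (0, 0) l k2).2 <= (nth (0, 0) l k1).1.
  by move=> k12; move/(pairwiseP (0, 0)): lpw; apply => //; rewrite inE.
by case/orP => /lt0; [lra|lra].
Qed.

Lemma integrable_patch (R : realType) (D : set R) (f : R -> R) :
  measurable D ->
  (@lebesgue_measure R).-integrable D (EFin \o f) ->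
  (@lebesgue_measure R).-integrable setT (EFin \o (f \_ D)).
Proof.
move=> mD; rewrite -restrict_EFin.
exact: (@integrable_mkcond _ _ R lebesgue_measure D (EFin \o f) mD).1.
Qed.

(** [V t] integrates [g] over the part of [U] to the left of [t]. It serves as a budget for what has
    been spent on [U] so far, be it length or integral of |f|. *)
Lemma cumulative_restrict (R : realType) (U : set R) (g : R -> R) :
  measurable U -> (@lebesgue_measure R).-integrable U (EFin \o g) ->
  (forall x, 0 <= g x) ->
  exists V : R -> R,
    [/\ forall t, 0 <= V t,
        forall t, V t <= \int[@lebesgue_measure R]_(x in U) g x,
        {homo V : s t / s <= t}
      & forall s t, s <= t -> `]s, t] `<=` U ->
          V t - V s = \int[@lebesgue_measure R]_(x in `]s, t]) g x].
Proof.
move=> mU ig g0.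
have ig' : (@lebesgue_measure R).-integrable setT (EFin \o (g \_ U)).
  exact: integrable_patch.
have ig'S D : measurable D ->
    (@lebesgue_measure R).-integrable D (EFin \o (g \_ U)).
  by move=> mD; exact: (integrableS measurableT mD (@subsetT _ D) ig').
have g'0 x : 0 <= (g \_ U) x by rewrite patchE; case: ifP.
have VB s t : s <= t ->
    \int[@lebesgue_measure R]_(x in `]-oo, t]) (g \_ U) x
    - \int[@lebesgue_measure R]_(x in `]-oo, s]) (g \_ U) x
    = \int[@lebesgue_measure R]_(x in `]s, t]) (g \_ U) x.
  by move=> st; rewrite Rintegral_itvB//; exact: ig'S.
exists (fun t => \int[@lebesgue_measure R]_(x in `]-oo, t]) (g \_ U) x).
split.
- by move=> t; apply: Rintegral_ge0.
- move=> t; rewrite [leRHS]Rintegral_mkcond.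
  rewrite [leLHS]Rintegral_mkcond; apply: le_Rintegral => //.
    by apply: integrable_patch => //; exact: ig'S.
  by move=> x _; rewrite {1}patchE; case: ifP.
- by move=> s t /VB st; rewrite -subr_ge0 st; exact: Rintegral_ge0.
- move=> s t /VB -> stU; apply: eq_Rintegral => x /set_mem /stU xU.
  by rewrite patchE mem_set.
Qed.

Lemma is_derive_dist (R : realType) (f : R -> R) (x l e : R) :
  is_derive x 1 f l -> 0 < e -> exists2 d, 0 < d &
    forall y, `|y - x| < d -> `|f y - f x - l * (y - x)| <= e * `|y - x|.
Proof.
move=> [/derivable1_diffP df dfx] e0.
have := derivable1_diffP f x; case=> _ /(_ df) dvf.
have : h^-1 *: (f (h + x) - f x) @[h --> 0^'] --> l.
  rewrite -dfx; have := dvf; rewrite /derivable /derive.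
  by under eq_fun do rewrite /= [_ *: 1]mulr1.
move=> /cvgrPdist_le/(_ _ e0) [d /= d0 Hd]; exists d => // y yd.
have [->|yx] := eqVneq y x; first by rewrite !subrr mulr0 subrr normr0 mulr0.
have yx0 : y - x != 0 by rewrite subr_eq0.
have := Hd (y - x); rewrite /= sub0r normrN => /(_ yd yx0).
rewrite subrK => h.
rewrite (_ : f y - f x - l * (y - x)
  = (y - x) * ((y - x)^-1 *: (f y - f x) - l)); last first.
  by rewrite /GRing.scale/=; field.
by rewrite normrM mulrC ler_wpM2r// distrC.
Qed.

(* The intervals on which H is not controlled by the derivative of H - F lie in
   the small open set U; they are collected in l while t runs from al to be. *)
Lemma ac_increment (R : realType) (D : set R) (f F H : R -> R) (al be e : R) :
  al <= be -> 0 < e ->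
  (forall x, al <= x <= be -> D x) ->
  abs_continuous_on D H ->
  (@lebesgue_measure R).-integrable setT (EFin \o f) ->
  (forall s t, s <= t -> F t - F s = \int[@lebesgue_measure R]_(x in `]s, t]) f x) ->
  exists2 d : R, 0 < d & forall U : set R, open U ->
    (@lebesgue_measure R U < d%:E)%E ->
    (forall x, al <= x <= be -> U x \/ is_derive x 1 (H - F) 0) ->
  `|(H - F) be - (H - F) al| <= e.
Proof.
move=> albe e0 sub acH intf FB.
have e4 : 0 < e / 4 by lra.
(* One quarter of [e] is allotted to each of three errors: the variation of [H] on [U], the integral
   of |f| on [U], and the slopes off [U]. *)
have [d1 d10 Hd1] := abs_continuous_on_seq acH e4.
have [d2 [d20 Hd2]] := integral_normr_continuous intf e4.
exists (Num.min d1 d2) => [|U oU Ud cover]; first by rewrite lt_min d10.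
have mU : measurable U by exact: open_measurable.
have Ufin : (@lebesgue_measure R U < +oo)%E by rewrite (lt_trans Ud)// ltry.
have Ud1 : (@lebesgue_measure R U < d1%:E)%E.
  by rewrite (lt_le_trans Ud)// lee_fin ge_min lexx.
have Ud2 : (@lebesgue_measure R U < d2%:E)%E.
  by rewrite (lt_le_trans Ud)// lee_fin ge_min lexx orbT.
have intfU : (@lebesgue_measure R).-integrable U (EFin \o (fun x => `|f x|)).
  apply: integrable_norm.
  by apply: (integrableS measurableT).
have int1U : (@lebesgue_measure R).-integrable U (EFin \o (cst (1 : R))).
  by apply: measurable_bounded_integrable => //; exact: bounded_cst.
have [V [V0 VU Vmono VB]] := cumulative_restrict mU intfU (fun x => normr_ge0 _).
have [m [m0 mU' mmono mB]] := cumulative_restrict mU int1U (fun x => ler01).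
rewrite Rintegral_cst// mul1r in mU'.
have fU : fine (@lebesgue_measure R U) < d1.
  rewrite -lte_fin fineK// ge0_fin_numE//.
pose G := H - F.
(* The added 1 keeps the divisor positive when [al = be]. *)
pose eta := e / 4 / (be - al + 1).
have eta0 : 0 < eta by rewrite divr_gt0//; lra.
pose P t := exists l : seq (R * R),
  [/\ forall u, u \in l -> [/\ al <= u.1, u.1 <= u.2 & u.2 <= t],
      pairwise (fun u v => v.2 <= u.1) l,
      \sum_(u <- l) (u.2 - u.1) <= m t &
      `|G t - G al| <= eta * (t - al) + \sum_(u <- l) `|H u.2 - H u.1| + V t].
have : P be.
  apply: (@real_induction R P al be) => //.
    exists [::]; split=> //; first by rewrite big_nil.
    by rewrite !subrr normr0 mulr0 big_nil !add0r.
  move=> t tab.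
  (* Where the slope of [G] is at most [eta], the first term absorbs the increment and [l] stays as
     it is. *)
  have good s r : al <= s -> s <= r -> `|G r - G s| <= eta * (r - s) -> P s -> P r.
    move=> als sr grs [l [l1 l2 l3 l4]]; exists l; split => //.
    - by move=> u /l1[? ? ?]; split => //; by lra.
    - by rewrite (le_trans l3)// mmono.
    - have := ler_distD (G s) (G r) (G al); have := mmono _ _ sr; have := Vmono _ _ sr.
      move: grs l4; lra.
  (* An interval inside [U] is consed to [l]: its length is paid from [m], the increment of [H] from
     the sum over [l], that of [F] from [V]. *)
  have bad s r : al <= s -> s <= r -> `[s, r] `<=` U -> P s -> P r.
    move=> als sr srU [l [l1 l2 l3 l4]]; exists ((s, r) :: l).
    have srU' : `]s, r] `<=` U by apply: subset_trans srU; exact: subset_itv_oc_cc.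
    split.
    - move=> u; rewrite inE => /orP[/eqP -> //|/l1[? ? ?]].
      by split => //; by lra.
    - by rewrite /= l2 andbT; apply/allP => u /l1[].
    - rewrite big_cons/= -lerBrDl; apply: (le_trans l3).
      rewrite lerBrDl -lerBrDr mB// Rintegral_cst//=.
      rewrite lebesgue_measure_itv/= lte_fin mul1r.
      case: ltP => [sr'|rs]; rewrite /= -?EFinD//.
      by rewrite (_ : s = r) ?subrr//; apply: le_anti; rewrite sr rs.
    - rewrite big_cons/=.
      have : `|F r - F s| <= V r - V s.
        rewrite VB// FB//; apply: le_normr_Rintegral => //.
        by apply: (integrableS measurableT).
      have : `|G r - G s| <= `|H r - H s| + `|F r - F s|.
        have -> : G r - G s = (H r - H s) - (F r - F s).
          by rewrite /G !fctE; ring.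
        exact: ler_normB.
      have : 0 <= eta * (r - s) by rewrite mulr_ge0 ?subr_ge0// ltW.
      have := ler_distD (G s) (G r) (G al); move: l4.
      rewrite !mulrBr; lra.
  have [Ut|dt] := cover t tab.
    have /open_nbhs_nbhs/nbhs_ballP[d /= d0 dU] : open_nbhs t U by split.
    have ballU s r : s <= t -> t <= r -> t - s < d -> r - t < d -> `[s, r] `<=` U.
      move=> st tr ts rt x/=; rewrite in_itv/= => /andP[sx xr]; apply: dU.
      rewrite /ball/= ltr_distlC; apply/andP; split; lra.
    exists d => // s r /andP[als st] /andP[tr rbe] ts rt; split.
      by apply: bad => //; apply: ballU => //; rewrite subrr.
    by apply: bad => //; [lra|apply: ballU => //; rewrite subrr].
  have [d d0 dG'] : exists2 d, 0 < d &
      forall s, `|s - t| < d -> `|G s - G t| <= eta * `|s - t|.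
    have [d d0 dG] := is_derive_dist dt eta0; exists d => // s /dG.
    by rewrite mul0r subr0.
  exists d => // s r /andP[als st] /andP[tr rbe] ts rt; split.
    apply: good => //; rewrite distrC -(ger0_norm (_ : 0 <= t - s)) ?subr_ge0//.
    by rewrite (distrC t s); apply: dG'; rewrite distrC ger0_norm// subr_ge0.
  apply: good => //; first by lra.
  rewrite -(ger0_norm (_ : 0 <= r - t)) ?subr_ge0//.
  by apply: dG'; rewrite ger0_norm// subr_ge0.
move=> [l [l1 l2 l3 l4]].
have l5 : \sum_(u <- l) `|H u.2 - H u.1| < e / 4.
  apply: Hd1 => //.
    move=> u /l1[? ? ?]; split => //; apply: sub; lra.
  exact: (le_lt_trans l3 (le_lt_trans (mU' _) fU)).
have l6 : V be < e / 4 by apply: le_lt_trans (VU _) (Hd2 _ mU Ud2).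
have l7 : eta * (be - al) <= e / 4.
  rewrite /eta -mulrA ler_piMr ?(ltW e4)// mulrC ler_pdivrMr; lra.
rewrite -/G; move: l4; lra.
Qed.

Lemma indefinite_integral_continuous (R : realType) (f F : R -> R) :
  (@lebesgue_measure R).-integrable setT (EFin \o f) ->
  (forall s t, s <= t -> F t - F s = \int[@lebesgue_measure R]_(x in `]s, t]) f x) ->
  continuous F.
Proof.
move=> intf FB x; apply/cvgrPdist_lt => e e0.
have [d [d0 Hd]] := integral_normr_continuous intf e0.
have Fst s t : s <= t -> t - s < d -> `|F t - F s| < e.
  move=> st std; rewrite FB//.
  apply: (@le_lt_trans _ _ (\int[@lebesgue_measure R]_(x in `]s, t]) `|f x|)).
    by apply: le_normr_Rintegral => //; apply: (integrableS measurableT).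
  apply: Hd => //; rewrite /= lebesgue_measure_itv/= lte_fin.
  by case: ifP => _; rewrite -?EFinB lte_fin.
exists d => // y /=; rewrite /ball/= => xy.
have [yx|yx] := leP y x.
  by apply: Fst => //; apply: le_lt_trans xy; exact: ler_norm.
by rewrite distrC Fst ?(ltW yx)//; apply: le_lt_trans xy; rewrite distrC ler_norm.
Qed.

(** With [F] the indefinite integral of [h] extended by zero, [H - F] has derivative zero off a null
    set. Open covers of that set of small measure make the increments of [H - F] arbitrarily small,
    so it is constant inside the interval; continuity of [F] then gives the limits at the ends. *)
Lemma ac_FTC (R : realType) (a b A B : R) (H h : R -> R) :
  a < b -> abs_continuous_on `]a, b[ H ->
  {ae @lebesgue_measure R, forall x : R, x \in `]a, b[ -> is_derive x 1 H (h x)} ->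
  (@lebesgue_measure R).-integrable `]a, b[ (EFin \o h) ->
  H x @[x --> a^'+] --> A -> H x @[x --> b^'-] --> B ->
  \int[@lebesgue_measure R]_(x in `]a, b[) h x = B - A.
Proof.
move=> ab acH dH inth HA HB.
pose f : R -> R := h \_ `]a, b[.
have intf : (@lebesgue_measure R).-integrable setT (EFin \o f).
  exact: integrable_patch.
have intfS D : measurable D -> (@lebesgue_measure R).-integrable D (EFin \o f).
  by move=> mD; apply: (integrableS measurableT).
pose F t := \int[@lebesgue_measure R]_(x in `]-oo, t]) f x.
have FB s t : s <= t -> F t - F s = \int[@lebesgue_measure R]_(x in `]s, t]) f x.
  by move=> st; rewrite /F Rintegral_itvB//; exact: intfS.
have cF := indefinite_integral_continuous intf FB.
(* By Lebesgue differentiation [F] has derivative [f] almost everywhere. *)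
have dF : {ae @lebesgue_measure R, forall x : R, is_derive x 1 F (f x)}.
  have /(FTC1Ny (fun y => intfS _ (measurable_itv _))) : locally_integrable setT f.
    by apply: open_integrable_locally => //; exact: openT.
  apply: filterS; first exact: (ae_filter_ringOfSetsType lebesgue_measure).
  move=> x [dF Fx]; rewrite -Fx derive1E; exact: derivableP.
have [N [mN N0 HN]] : (@lebesgue_measure R).-negligible
    (~` [set x | x \in `]a, b[ -> is_derive x 1 (H - F) 0]).
  have : {ae @lebesgue_measure R, forall x : R, x \in `]a, b[ -> is_derive x 1 (H - F) 0}.
    have := dF; have := dH; apply: filterS2.
      exact: (ae_filter_ringOfSetsType lebesgue_measure).
    move=> x dHx dFx xab; have {}dHx := dHx xab.
    apply: is_derive_eq; rewrite /f patchE mem_set// subrr.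
    by [].
  by [].
have Gcst al be : a < al -> al <= be -> be < b -> (H - F) be = (H - F) al.
  move=> aal albe beb.
  apply/eqP; rewrite -subr_eq0 -normr_le0; apply/ler_addgt0Pl => e e0; rewrite addr0.
  have sub x : al <= x <= be -> `]a, b[%classic x.
    by move=> /andP[? ?]; rewrite /= in_itv/=; lra.
  have [d d0 Hd] := ac_increment albe e0 sub acH intf FB.
  (* Outer regularity bounds the measure of [U] minus [N], which is that of [U] because [N] is
     null. *)
  have [||U [oU NU Ud]] := @lebesgue_regularity_outer R N d mN => //.
    by rewrite [ltLHS]N0 ltry.
  apply: (Hd U) => //.
    rewrite -(setDUK NU) measureU//; last by rewrite setDIK.
      by rewrite [X in (X + _)%E]N0 add0e.
    by apply: measurableD => //; exact: open_measurable.
  move=> x xab; have [Nx|Nx] := pselect (N x); [by left; exact: NU|right].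
  by apply: contrapT => nd; apply: Nx; apply: HN => /= /(_ (sub _ xab)).
(* The value of [H - F] at the midpoint is the constant. *)
pose c := (a + b) / 2.
have acb : a < c < b by rewrite /c; apply/andP; split; lra.
have HF x : a < x < b -> H x = (H - F) c + F x.
  move=> /andP[ax xb]; apply/eqP; rewrite -subr_eq; apply/eqP.
  rewrite -[LHS]/((H - F) x); case/andP: acb => ac cb.
  by have [xc|cx] := leP x c; [apply/esym/Gcst|apply: Gcst => //; exact: ltW].
have HFa : A = (H - F) c + F a.
  apply: (@cvg_unique _ _ (H x @[x --> a^'+])) => //=.
  have : (fun x => (H - F) c + F x) x @[x --> a^'+] --> (H - F) c + F a.
    by apply: cvgD; [exact: cvg_cst|apply: cvg_at_right_filter; exact: cF].
  apply: cvg_trans; apply: near_eq_cvg; near=> x.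
  rewrite HF//; apply/andP; split; near: x; first exact: nbhs_right_gt.
  exact: nbhs_right_lt.
have HFb : B = (H - F) c + F b.
  apply: (@cvg_unique _ _ (H x @[x --> b^'-])) => //=.
  have : (fun x => (H - F) c + F x) x @[x --> b^'-] --> (H - F) c + F b.
    by apply: cvgD; [exact: cvg_cst|apply: cvg_at_left_filter; exact: cF].
  apply: cvg_trans; apply: near_eq_cvg; near=> x.
  rewrite HF//; apply/andP; split; near: x; first exact: nbhs_left_gt.
  exact: nbhs_left_lt.
rewrite HFa HFb opprD addrACA subrr add0r FB ?(ltW ab)//.
rewrite -Rintegral_itv_bndo_bndc; last exact: intfS.
by apply: eq_Rintegral => x xab; rewrite /f patchE xab.
Unshelve. all: by end_near. Qed.

(** * Bounded measurable functions and the algebra of absolute continuity *)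

(** This class is closed under sums and products, consists of integrable functions and multiplies
    integrable functions into integrable ones; it settles the integrability conditions below. *)
Definition mbounded (R : realType) (a b : R) (f : R -> R) : Prop :=
  measurable_fun `]a, b[ f /\ exists M : R, forall x : R, x \in `]a, b[ -> `|f x| <= M.

Section mbounded.
Context {R : realType} (a b : R).
Implicit Types f g : R -> R.
Notation mu := (@lebesgue_measure R).

Lemma mboundedD f g : mbounded a b f -> mbounded a b g ->
  mbounded a b (fun x => f x + g x).
Proof.
move=> [mf [M fM]] [mg [N gN]]; split; first exact: measurable_funD.
by exists (M + N) => x xab; rewrite (le_trans (ler_normD _ _))// lerD ?fM ?gN.
Qed.

Lemma mboundedM f g : mbounded a b f -> mbounded a b g ->
  mbounded a b (fun x => f x * g x).
Proof.
move=> [mf [M fM]] [mg [N gN]]; split; first exact: measurable_funM.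
by exists (M * N) => x xab; rewrite normrM ler_pM ?fM ?gN.
Qed.

Lemma mbounded_cst c : mbounded a b (fun=> c).
Proof. by split; [exact: measurable_cst|exists `|c| => x _]. Qed.

Lemma mboundedN f : mbounded a b f -> mbounded a b (fun x => - f x).
Proof.
move=> [mf [M fM]]; split; first exact: measurable_funN.
by exists M => x xab; rewrite normrN fM.
Qed.

Lemma mboundedB f g : mbounded a b f -> mbounded a b g ->
  mbounded a b (fun x => f x - g x).
Proof. by move=> mf /mboundedN; exact: mboundedD. Qed.

Lemma mbounded_continuous f : a <= b -> continuous f -> mbounded a b f.
Proof.
move=> ab cf; split.
  by apply: measurable_funS (continuous_measurable_fun cf).
have cn : {within `[a, b], continuous (fun x => `|f x|)}.
  apply: continuous_subspaceT => x.
  by apply: continuous_comp; [exact: cf|exact: norm_continuous].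
have [c _ cM] := EVT_max ab cn.
exists `|f c| => x; rewrite in_itv/= => /andP[ax xb].
by apply: cM; rewrite in_itv/= !ltW.
Qed.

Lemma mbounded_integrable f : mbounded a b f -> mu.-integrable `]a, b[ (EFin \o f).
Proof.
move=> [mf [M fM]]; apply: measurable_bounded_integrable => //.
  by rewrite /= lebesgue_measure_itv/=; case: ifP => _; rewrite -?EFinB ltry.
exists M; split; first exact: num_real.
by move=> N MN x xab /=; rewrite (le_trans (fM _ _))// ltW.
Qed.

Lemma mboundedM_integrable f g : mbounded a b f ->
  mu.-integrable `]a, b[ (EFin \o g) ->
  mu.-integrable `]a, b[ (EFin \o (fun x => f x * g x)).
Proof.
move=> [mf [M fM]] ig.
have -> : EFin \o (fun x => f x * g x) = ((EFin \o f) \* (EFin \o g))%E by [].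
apply: integrableMr => //; exists M; split; first exact: num_real.
by move=> N MN x xab /=; rewrite (le_trans (fM _ _))// ltW.
Qed.

Lemma integrable_EFinD (D : set R) f g :
  measurable D ->
  mu.-integrable D (EFin \o f) -> mu.-integrable D (EFin \o g) ->
  mu.-integrable D (EFin \o (fun x => f x + g x)).
Proof.
move=> mD intf intg.
have -> : EFin \o (fun x => f x + g x) = ((EFin \o f) \+ (EFin \o g))%E by [].
exact: integrableD.
Qed.

Lemma integrable_EFinB (D : set R) f g :
  measurable D ->
  mu.-integrable D (EFin \o f) -> mu.-integrable D (EFin \o g) ->
  mu.-integrable D (EFin \o (fun x => f x - g x)).
Proof.
move=> mD intf intg.
have -> : EFin \o (fun x => f x - g x) = ((EFin \o f) \- (EFin \o g))%E by [].
exact: integrableB.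
Qed.

Lemma abs_continuous_on_lipschitz (D : set R) K f :
  (forall x y, D x -> D y -> x <= y -> `|f y - f x| <= K * (y - x)) ->
  abs_continuous_on D f.
Proof.
(* [K] may be zero or negative, hence the positive constant |K| + 1. *)
move=> fK e e0; have K0 : 0 < `|K| + 1 by rewrite ltr_wpDl.
exists (e / (`|K| + 1)); first exact: divr_gt0.
move=> n x y xy _ sxy.
apply: (@le_lt_trans _ _ (\sum_i (`|K| + 1) * (y i - x i))).
  apply: ler_sum => i _; have [Dx Dy le_xy] := xy i.
  apply: (le_trans (fK _ _ Dx Dy le_xy)); rewrite ler_wpM2r ?subr_ge0//.
  by rewrite (le_trans (ler_norm _))// lerDl.
by rewrite -mulr_sumr mulrC -ltr_pdivlMr.
Qed.

Lemma abs_continuous_onD (D : set R) f g :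
  abs_continuous_on D f -> abs_continuous_on D g ->
  abs_continuous_on D (fun x => f x + g x).
Proof.
move=> acf acg e e0; have e2 : 0 < e / 2 by lra.
have [d d0 Hd] := acf _ e2; have [d' d'0 Hd'] := acg _ e2.
exists (Num.min d d'); first by rewrite lt_min d0.
move=> n x y xy tri; rewrite lt_min => /andP[sd sd'].
have := Hd n x y xy tri sd; have := Hd' n x y xy tri sd'.
suff : \sum_i `|f (y i) + g (y i) - (f (x i) + g (x i))| <=
       \sum_i `|f (y i) - f (x i)| + \sum_i `|g (y i) - g (x i)| by lra.
rewrite -big_split/=; apply: ler_sum => i _.
by rewrite opprD addrACA ler_normD.
Qed.

Lemma abs_continuous_onM (D : set R) M N f g :
  abs_continuous_on D f -> abs_continuous_on D g ->
  (forall x, D x -> `|f x| <= M) -> (forall x, D x -> `|g x| <= N) ->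
  abs_continuous_on D (fun x => f x * g x).
Proof.
move=> acf acg fM gN e e0.
have M0 : 0 < `|M| + 1 by rewrite ltr_wpDl.
have N0 : 0 < `|N| + 1 by rewrite ltr_wpDl.
have [d d0 Hd] := acf _ (divr_gt0 (divr_gt0 e0 (@ltr0Sn R 1)) N0).
have [d' d'0 Hd'] := acg _ (divr_gt0 (divr_gt0 e0 (@ltr0Sn R 1)) M0).
exists (Num.min d d'); first by rewrite lt_min d0.
move=> n x y xy tri; rewrite lt_min => /andP[sd sd'].
have := Hd n x y xy tri sd; have := Hd' n x y xy tri sd'.
rewrite !ltr_pdivlMr// => h1 h2.
suff : \sum_i `|f (y i) * g (y i) - f (x i) * g (x i)| <=
       (\sum_i `|f (y i) - f (x i)|) * (`|N| + 1)
       + (\sum_i `|g (y i) - g (x i)|) * (`|M| + 1) by lra.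
rewrite !mulr_suml -big_split/=; apply: ler_sum => i _.
have [Dx Dy _] := xy i.
have -> : f (y i) * g (y i) - f (x i) * g (x i) =
  (f (y i) - f (x i)) * g (y i) + (g (y i) - g (x i)) * f (x i) by ring.
apply: (le_trans (ler_normD _ _)); rewrite !normrM lerD// ler_wpM2l//.
  by rewrite (le_trans (gN _ Dy))// (le_trans (ler_norm _))// lerDl.
by rewrite (le_trans (fM _ Dx))// (le_trans (ler_norm _))// lerDl.
Qed.

(** A family consisting of one interval is enough. *)
Lemma abs_continuous_on_uniform (D : set R) f e : abs_continuous_on D f -> 0 < e ->
  exists2 d, 0 < d & forall x y, D x -> D y -> `|y - x| < d -> `|f y - f x| < e.
Proof.
move=> acf e0; have [d d0 Hd] := acf _ e0; exists d => // x y.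
wlog xy : x y / x <= y.
  move=> wl xab yab xyd; have [xy|/ltW yx] := leP x y; first exact: wl.
  by rewrite distrC wl// distrC.
move=> xab yab; rewrite ger0_norm ?subr_ge0// => xyd.
have := Hd 1 (fun=> x) (fun=> y); rewrite !big_ord1; apply => //.
by move=> i j _ _ _; rewrite (ord1 i) (ord1 j).
Qed.

(** A step shorter than [d] changes [f] by less than 1, and a bounded number of such steps leads
    from the midpoint to any point of the interval. *)
Lemma abs_continuous_on_bounded f : abs_continuous_on `]a, b[ f ->
  exists M : R, forall x : R, x \in `]a, b[ -> `|f x| <= M.
Proof.
move=> acf; have [d d0 step] := abs_continuous_on_uniform acf ltr01.
pose c := (a + b) / 2.
have far (n : nat) x : x \in `]a, b[ -> `|x - c| < n.+1%:R * d ->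
    `|f x - f c| < n.+1%:R.
  move=> xab; have cab : c \in `]a, b[.
    by move: xab; rewrite !in_itv/= /c => /andP[? ?]; apply/andP; split; lra.
  elim: n x xab => [|n IHn] x xab xc; first by apply: step => //; rewrite mul1r in xc.
  (* The point [z] divides the segment from [c] to [x] so that the first piece is shorter than n+1
     steps and the second shorter than one. *)
  pose t : R := n.+1%:R / n.+2%:R.
  have n20 : 0 < n.+2%:R :> R by [].
  have t01 : 0 < t < 1.
    apply/andP; split; first exact: divr_gt0.
    by rewrite /t ltr_pdivrMr// mul1r ltr_nat.
  have tE : (1 - t) * n.+2%:R = 1.
    by rewrite /t mulrBl mul1r divfK ?gt_eqF// -natrB// subSnn.
  pose z := c + t * (x - c).
  have zab : z \in `]a, b[.
    move: xab cab; rewrite !in_itv/= /z => /andP[ax xb] /andP[ac cb].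
    by apply/andP; split; nra.
  have zc : `|z - c| < n.+1%:R * d.
    rewrite /z addrAC subrr add0r normrM gtr0_norm; last by case/andP: t01.
    by rewrite /t mulrAC ltr_pdivrMr// -mulrA ltr_pM2l// mulrC.
  have xz : `|x - z| < d.
    have -> : x - z = (1 - t) * (x - c) by rewrite /z; ring.
    rewrite normrM gtr0_norm; last by rewrite subr_gt0; case/andP: t01.
    rewrite -(ltr_pM2r n20) mulrAC tE mul1r.
    by rewrite [d * _]mulrC.
  have h1 := IHn z zab zc; have h2 := step z x zab xab xz.
  rewrite (le_lt_trans (ler_distD (f z) _ _))// -[n.+2]addn1 natrD addrC ltrD//.
have [ba|ab] := leP b a.
  by exists 0 => x; rewrite in_itv/= => /andP[ax /(lt_trans ax)]; rewrite ltNge ba.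
pose n := Num.truncn ((b - a) / d).
exists (`|f c| + n.+1%:R) => x xab.
have {}far : `|f x - f c| < n.+1%:R.
  apply: far => //; rewrite -ltr_pdivrMr//.
  apply: le_lt_trans (truncnS_gt _); rewrite ler_pM2r ?invr_gt0//.
  move: xab; rewrite in_itv/= /c => /andP[ax xb].
  by rewrite ler_norml; apply/andP; split; lra.
by have := ler_normD (f x - f c) (f c); rewrite subrK; lra.
Qed.

Section bounded_derivative.
Variables f f' : R -> R.
Hypothesis df : forall x, x \in `]a, b[ -> is_derive x 1 f (f' x).

Lemma derivable_measurable : measurable_fun `]a, b[ f.
Proof.
apply: open_continuous_measurable_fun; first exact: interval_open.
move=> x /set_mem xab; apply/differentiable_continuous/derivable1_diffP.
by case: (df xab).
Qed.

Variable K : R.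
Hypothesis f'K : forall x, x \in `]a, b[ -> `|f' x| <= K.

(** By the mean value theorem [K] is a Lipschitz constant. *)
Lemma bounded_derivative_abs_continuous : abs_continuous_on `]a, b[ f.
Proof.
apply: (@abs_continuous_on_lipschitz _ K) => x y xab yab xy.
have sub z : z \in `[x, y] -> z \in `]a, b[.
  move: xab yab; rewrite /= !in_itv/= => /andP[ax _] /andP[_ yb] /andP[xz zy].
  by apply/andP; split; lra.
have dxy z : z \in `]x, y[ -> is_derive z 1 f (f' z).
  by move=> zxy; apply/df/sub/subset_itv_oo_cc.
have cxy : {within `[x, y], continuous f}.
  by apply: derivable_within_continuous => z /sub/df[].
have [z zxy fE] := MVT_segment xy dxy cxy.
rewrite fE normrM (ger0_norm (_ : 0 <= y - x)) ?subr_ge0//.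
by rewrite ler_wpM2r ?subr_ge0// f'K// sub.
Qed.

Lemma bounded_derivative_mbounded : mbounded a b f.
Proof.
split; first exact: derivable_measurable.
exact: abs_continuous_on_bounded bounded_derivative_abs_continuous.
Qed.

End bounded_derivative.

End mbounded.

Lemma abs_continuous_measurable (R : realType) (a b : R) (f : R -> R) :
  abs_continuous_on `]a, b[ f -> measurable_fun `]a, b[ f.
Proof.
move=> acf; apply: open_continuous_measurable_fun; first exact: interval_open.
move=> x /set_mem xab; apply/cvgrPdist_lt => e e0.
have [d d0 Hd] := abs_continuous_on_uniform acf e0.
near=> y; apply: Hd => //; first by near: y; exact: near_in_itvoo.
Unshelve. all: by end_near. Qed.

Lemma abs_continuous_mbounded (R : realType) (a b : R) (f : R -> R) :
  abs_continuous_on `]a, b[ f -> mbounded a b f.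
Proof.
split; first exact: abs_continuous_measurable.
exact: abs_continuous_on_bounded.
Qed.

(** * Integration by parts *)

Lemma cvg0_mul_bounded (R : realType) (F : set_system R) (f g : R -> R) (M : R) :
  Filter F -> f x @[x --> F] --> (0 : R) ->
  (\forall x \near F, `|g x| <= M) -> f x * g x @[x --> F] --> (0 : R).
Proof.
move=> FF f0 gM; apply/cvgr0Pnorm_lt => e e0.
have M0 : 0 < `|M| + 1 by rewrite ltr_wpDl.
move/cvgr0Pnorm_lt : f0 => /(_ _ (divr_gt0 e0 M0)) f0.
near=> x; rewrite normrM.
have h1 : `|f x| < e / (`|M| + 1) by near: x.
have h2 : `|g x| <= `|M| + 1.
  by rewrite (@le_trans _ _ M)//; [near: x|rewrite (le_trans (ler_norm _))// lerDl].
apply: le_lt_trans (ler_wpM2l (normr_ge0 _) h2) _.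
by rewrite -ltr_pdivlMr.
Unshelve. all: by end_near. Qed.

(** This is the fundamental theorem for the absolutely continuous function [A v + B]. The summand
    [B] holds the terms of a second integration by parts, so that boundary limits are asked of the
    whole expression only. *)
Lemma ac_integration_by_parts (R : realType) (a b la lb : R)
  (A A' B B' v v' : R -> R) :
  a < b ->
  (forall x, x \in `]a, b[ -> is_derive x 1 A (A' x)) -> mbounded a b A' ->
  (forall x, x \in `]a, b[ -> is_derive x 1 B (B' x)) -> mbounded a b B' ->
  abs_continuous_on `]a, b[ v ->
  {ae @lebesgue_measure R, forall x : R, x \in `]a, b[ -> is_derive x 1 v (v' x)} ->
  (@lebesgue_measure R).-integrable `]a, b[ (EFin \o v') ->
  A x * v x + B x @[x --> a^'+] --> la ->
  A x * v x + B x @[x --> b^'-] --> lb ->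
  \int[@lebesgue_measure R]_(x in `]a, b[) (A x * v' x + (A' x * v x + B' x))
    = lb - la.
Proof.
move=> ab dA [mA' [K A'K]] dB [mB' [K' B'K']] acv dv iv' cva cvb.
have acA := bounded_derivative_abs_continuous dA A'K.
have acB := bounded_derivative_abs_continuous dB B'K'.
have [_ [M AM]] := bounded_derivative_mbounded dA A'K.
have [N vN] := abs_continuous_on_bounded acv.
apply: ac_FTC cva cvb => //.
- apply: abs_continuous_onD; last exact: acB.
  exact: abs_continuous_onM acA acv AM vN.
- move: dv; apply: filterS; first exact: (ae_filter_ringOfSetsType lebesgue_measure).
  move=> x dvx xab; have {}dvx := dvx xab; have dAx := dA x xab; have dBx := dB x xab.
  have -> : (fun x => A x * v x + B x) = A * v + B by [].
  apply: is_derive_eq; rewrite /GRing.scale/=; ring.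
- apply: integrable_EFinD => //.
    apply: mboundedM_integrable => //; split; last by exists M.
    exact: derivable_measurable dA.
  apply: mbounded_integrable; apply: mboundedD; last by split => //; exists K'.
  apply: mboundedM; first by split => //; exists K.
  by split; [exact: abs_continuous_measurable|exists N].
Qed.

(** * The Dirichlet problem *)

Lemma is_derive_continuous (R : realType) (f : R -> R) (x df : R) :
  is_derive x 1 f df -> {for x, continuous f}.
Proof. by move=> [dfx _]; apply/differentiable_continuous/derivable1_diffP. Qed.

(** If g(x) < 0, the mean value theorem on [a, x] and on [x, b] gives g1(c1) < 0 < g1(c2) with c1 <
    c2, against the monotonicity of [g1]. *)
Lemma concave_ge0 (R : realType) (a b x : R) (g g1 g2 : R -> R) :
  (forall x : R, is_derive x 1 g (g1 x)) -> (forall x : R, is_derive x 1 g1 (g2 x)) ->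
  (forall x, a < x < b -> g2 x <= 0) -> g a = 0 -> g b = 0 -> a < x < b -> 0 <= g x.
Proof.
move=> dg dg1 g20 ga gb /andP[ax xb].
have within (f f' : R -> R) (u v : R) : (forall x : R, is_derive x 1 f (f' x)) ->
    {within `[u, v], continuous f}.
  by move=> df; apply: continuous_subspaceT => z; exact: is_derive_continuous (df z).
have [c1 + E1] := MVT ax (fun z _ => dg z) (within _ _ _ _ dg).
have [c2 + E2] := MVT xb (fun z _ => dg z) (within _ _ _ _ dg).
rewrite !in_itv/= => /andP[xc2 c2b] /andP[ac1 c1x].
have c12 : c1 < c2 by exact: lt_trans xc2.
have [c3 + E3] := MVT c12 (fun z _ => dg1 z) (within _ _ _ _ dg1).
rewrite in_itv/= => /andP[c13 c32].
have /g20 g2c3 : a < c3 < b by apply/andP; split; lra.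
have g1c : g1 c2 <= g1 c1 by rewrite -subr_le0 E3 mulr_le0_ge0// subr_ge0 ltW.
rewrite ga subr0 in E1; rewrite gb sub0r in E2.
rewrite leNgt; apply/negP => gx.
have h1 : g1 c1 < 0 by rewrite -(pmulr_llt0 _ (_ : 0 < x - a)) ?subr_gt0// -E1.
have h2 : 0 < g1 c2 by rewrite -(pmulr_lgt0 _ (_ : 0 < b - x)) ?subr_gt0// -E2 oppr_gt0.
lra.
Qed.

Lemma is_derive_expR_affine (R : realType) (c d x : R) :
  is_derive x 1 (fun x => expR (c * (x - d))) (c * expR (c * (x - d))).
Proof.
have h : is_derive x 1 (fun x : R => c * (x - d)) c.
  have -> : (fun x : R => c * (x - d)) = c \*: (id - cst d) by [].
  by apply: is_derive_eq; rewrite subr0 /GRing.scale/= mulr1.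
rewrite mulrC.
exact: (@is_derive1_comp R expR (fun x => c * (x - d)) x _ _ (is_derive_expR _) h).
Qed.

(* [y] is the function (1 - cosh (s (x - L/2)) / cosh (s L/2)) / k with
   s = sqrt k. *)
Lemma torsion_function (R : realType) (L k : R) : 0 < L -> 0 < k ->
  exists y y1 : R -> R,
    [/\ forall x : R, is_derive x 1 y (y1 x) /\ is_derive x 1 y1 (k * y x - 1),
        y 0 = 0, y L = 0,
        forall x, 0 < x < L ->
          [/\ 0 <= y x, y x <= k^-1 & y x <= x * (L - x) / 2]
      & y1 L - y1 0 = - (2 / Num.sqrt k * tanh (Num.sqrt k * L / 2))].
Proof.
move=> L0 k0; set s := Num.sqrt k; have s0 : 0 < s by rewrite sqrtr_gt0.
have s2 : s * s = k by rewrite -expr2 sqr_sqrtr// ltW.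
(* Centring at L/2 makes [e s + e (- s)] twice the hyperbolic cosine of s (x - L/2), with value [D]
   at both ends. *)
pose e (c x : R) := expR (c * (x - L / 2)).
pose D := expR (s * L / 2) + expR (- (s * L / 2)).
have D0 : 0 < D by rewrite addr_gt0// expR_gt0.
pose y : R -> R := cst k^-1 - (k^-1 / D) \*: (e s + e (- s)).
pose y1 : R -> R := - ((s / (k * D)) \*: (e s - e (- s))).
have k00 : k != 0 by rewrite gt_eqF.
have D00 : D != 0 by rewrite gt_eqF.
have s00 : s != 0 by rewrite gt_eqF.
have yE x : y x = k^-1 - k^-1 / D * (e s x + e (- s) x) by [].
have y1E x : y1 x = - (s / (k * D) * (e s x - e (- s) x)) by [].
have de (c x : R) : is_derive x 1 (e c) (c * e c x) by exact: is_derive_expR_affine.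
have dy (x : R) : is_derive x 1 y (y1 x).
  apply: is_derive_eq; rewrite y1E /GRing.scale/=; field.
  by rewrite k00 D00.
have dy1 (x : R) : is_derive x 1 y1 (k * y x - 1).
  apply: is_derive_eq; rewrite yE /GRing.scale/= -s2; field.
  by rewrite s00 D00.
have eL c : e c L = expR (c * L / 2) by rewrite /e; congr expR; field.
have e0 c : e c 0 = expR (- (c * L / 2)) by rewrite /e; congr expR; field.
have y0 : y 0 = 0 by rewrite yE !e0 !mulNr opprK (addrC (expR _)) -/D divfK ?subrr.
have yL : y L = 0 by rewrite yE !eL !mulNr -/D divfK ?subrr.
have yk x : y x <= k^-1.
  rewrite yE gerBl// mulr_ge0//.
    by rewrite divr_ge0// ?invr_ge0 ltW.
  by rewrite addr_ge0// expR_ge0.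
(* The bound y <= 1/k makes y'' = k y - 1 nonpositive, so [y] is concave. *)
have yge x : 0 < x < L -> 0 <= y x.
  apply: (concave_ge0 dy dy1) => // {}x _.
  by rewrite subr_le0 -(mulfV k00) ler_pM2l.
exists y, y1; split => //.
- move=> x x0L; split; [exact: yge|exact: yk|].
  rewrite -subr_ge0.
  pose q : R -> R := 2^-1 \*: (id * (cst L - id)).
  have dq (z : R) : is_derive z 1 q (L / 2 - z).
    by apply: is_derive_eq; rewrite /GRing.scale/= -[(cst L - id) z]/(L - z); field.
  have dq1 (z : R) : is_derive z 1 (fun z => L / 2 - z) (-1).
    have -> : (fun z => L / 2 - z) = cst (L / 2) - id by [].
    by apply: is_derive_eq; rewrite sub0r.
  (* The second derivative of [q - y] is -k y, nonpositive by [yge]. *)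
  have := @concave_ge0 R 0 L x (q - y) ((fun z => L / 2 - z) - y1)
    (fun z => -1 - (k * y z - 1)).
  have -> : (q - y) x = x * (L - x) / 2 - y x.
    by rewrite -[LHS]/(2^-1 * (x * (L - x)) - y x) mulrC.
  apply => //.
  + move=> z /yge yz /=; rewrite (_ : -1 - (k * y z - 1) = - (k * y z)); last by ring.
    by rewrite oppr_le0 mulr_ge0// ltW.
  + by rewrite -[LHS]/(2^-1 * (0 * (L - 0)) - y 0) y0; ring.
  + by rewrite -[LHS]/(2^-1 * (L * (L - L)) - y L) yL; ring.
- rewrite !y1E !eL !e0 /tanh !mulNr !opprK -/D -s2; field.
  by rewrite s00 D00.
Qed.

Lemma is_derive1M (R : realType) (f g : R -> R) (x df dg : R) :
  is_derive x 1 f df -> is_derive x 1 g dg ->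
  is_derive x 1 (fun x => f x * g x) (df * g x + f x * dg).
Proof.
move=> hf hg; have -> : (fun x => f x * g x) = f * g by [].
by apply: is_derive_eq; rewrite /GRing.scale/=; ring.
Qed.

(** Meant for the smoothed modulus sqrt (u^2 + e^2). Only powers of the inverse root occur in the
    derivatives, so their boundedness follows from that of [dg] and of the inverse root. *)
Lemma is_derive_inv_sqrt (R : realType) (g : R -> R) (x dg : R) :
  0 < g x -> is_derive x 1 g dg ->
  is_derive x 1 (fun x => Num.sqrt (g x)) (dg / 2 * (Num.sqrt (g x))^-1) /\
  is_derive x 1 (fun x => (Num.sqrt (g x))^-1) (- (dg / 2) * (Num.sqrt (g x))^-1 ^+ 3).
Proof.
move=> gx hg; pose r : R -> R := fun x => Num.sqrt (g x).
have r0 : r x != 0 by rewrite gt_eqF// sqrtr_gt0.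
have h : is_derive x 1 r (dg / 2 * (r x)^-1).
  have := @is_derive1_comp R Num.sqrt g x _ _ (is_derive1_sqrt gx) hg.
  by rewrite invfM mulrC mulrA.
split=> //; case: h => dr rE.
apply: DeriveDef; first exact: derivableV.
by rewrite deriveV// rE /GRing.scale/= -/(r x); field.
Qed.

(** A continuous derivative is bounded on the interval, so [ac_FTC] applies. *)
Lemma Rintegral_oo_FTC (R : realType) (a b : R) (H h : R -> R) :
  a < b -> (forall x : R, is_derive x 1 H (h x)) -> continuous h ->
  \int[@lebesgue_measure R]_(x in `]a, b[) h x = H b - H a.
Proof.
move=> ab dH ch.
have mh : mbounded a b h by apply: mbounded_continuous => //; exact: ltW.
have cH x : {for x, continuous H} by exact: is_derive_continuous (dH x).
apply: (@ac_FTC R a b _ _ H) => //.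
- case: mh => _ [M hM]; apply: bounded_derivative_abs_continuous hM => x _; exact: dH.
- by apply: aeW => x _; exact: dH.
- exact: mbounded_integrable.
- by apply: cvg_at_right_filter; exact: cH.
- by apply: cvg_at_left_filter; exact: cH.
Qed.

(** The boundary terms of the integrations by parts below have this shape. *)
Lemma cvg0_mul_mbounded2 (R : realType) (a b : R) (F : set_system R)
    (g1 h1 g2 h2 : R -> R) : Filter F ->
  (\forall x \near F, x \in `]a, b[) -> mbounded a b h1 -> mbounded a b h2 ->
  g1 x @[x --> F] --> (0 : R) -> g2 x @[x --> F] --> (0 : R) ->
  g1 x * h1 x + g2 x * h2 x @[x --> F] --> (0 : R).
Proof.
move=> FF Fin [_ [M1 hM1]] [_ [M2 hM2]] g10 g20.
rewrite -[X in _ --> X](addr0 0); apply: cvgD; apply: cvg0_mul_bounded => //.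
  by apply: filterS Fin => x; exact: hM1.
by apply: filterS Fin => x; exact: hM2.
Qed.

Lemma at_right_itv (R : realType) (a b : R) : a < b ->
  \forall x \near a^'+, x \in `]a, b[.
Proof.
move=> ab; near=> x; rewrite in_itv/=; apply/andP; split; near: x.
  exact: nbhs_right_gt.
exact: nbhs_right_lt.
Unshelve. all: by end_near. Qed.

Lemma at_left_itv (R : realType) (a b : R) : a < b ->
  \forall x \near b^'-, x \in `]a, b[.
Proof.
move=> ab; near=> x; rewrite in_itv/=; apply/andP; split; near: x.
  exact: nbhs_left_gt.
exact: nbhs_left_lt.
Unshelve. all: by end_near. Qed.

(** * Duality and the L^1 estimate for - u'' + k u = f with zero boundary limits *)

Section dirichlet.
Context {R : realType} (L k : R) (u v f : R -> R).
Notation mu := (@lebesgue_measure R).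
Hypothesis L0 : 0 < L.
Hypothesis du : forall x : R, x \in `]0, L[ -> is_derive x 1 u (v x).
Hypothesis acv : abs_continuous_on `]0, L[ v.
Hypothesis dv : {ae mu, forall x : R, x \in `]0, L[ -> is_derive x 1 v (k * u x - f x)}.
Hypothesis intf : mu.-integrable `]0, L[ (EFin \o f).
Hypothesis u0 : u x @[x --> 0^'+] --> (0 : R).
Hypothesis uL : u x @[x --> L^'-] --> (0 : R).

Lemma dirichlet_mbounded : mbounded 0 L u.
Proof.
have [_ [M vM]] := abs_continuous_mbounded acv.
exact (bounded_derivative_mbounded du vM).
Qed.

Lemma dirichlet_integrable : mu.-integrable `]0, L[ (EFin \o (fun x => k * u x - f x)).
Proof.
apply: integrable_EFinB => //; apply: mbounded_integrable.
by apply: mboundedM; [exact: mbounded_cst|exact: dirichlet_mbounded].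
Qed.

(** The operator is self-adjoint and - t'' + k t = q. Taking A = t and B = - u t' turns the
    integrand into q u - t f, and the boundary terms t v - u t' vanish because [v] and t' are
    bounded. *)
Lemma dirichlet_duality (t t1 q : R -> R) :
  (forall x : R, is_derive x 1 t (t1 x)) ->
  (forall x : R, is_derive x 1 t1 (k * t x - q x)) -> continuous q ->
  t 0 = 0 -> t L = 0 ->
  \int[mu]_(x in `]0, L[) (q x * u x) = \int[mu]_(x in `]0, L[) (t x * f x).
Proof.
move=> dt dt1 cq t0 tL.
have mbc (g : R -> R) : continuous g -> mbounded 0 L g.
  by move=> cg; apply: mbounded_continuous => //; exact: ltW.
have ct : continuous t by move=> x; exact: is_derive_continuous (dt x).
have ct1 : continuous t1 by move=> x; exact: is_derive_continuous (dt1 x).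
have [mt mt1 mq] : [/\ mbounded 0 L t, mbounded 0 L t1 & mbounded 0 L q].
  by split; exact: mbc.
have mbu := dirichlet_mbounded; have mbv := abs_continuous_mbounded acv.
have int1 := mboundedM_integrable mt intf.
have int2 := mbounded_integrable (mboundedM mq mbu).
have dB x : x \in `]0, L[ ->
    is_derive x 1 (fun x => u x * - t1 x) (v x * - t1 x + u x * - (k * t x - q x)).
  by move=> xL; exact (is_derive1M (du xL) (is_deriveN (dt1 x))).
have mB' : mbounded 0 L (fun x => v x * - t1 x + u x * - (k * t x - q x)).
  apply: mboundedD; apply: mboundedM => //; apply: mboundedN => //.
  by apply: mboundedB => //; apply: mboundedM => //; exact: mbounded_cst.
have mt1N := mboundedN mt1.
have t0F : t x @[x --> 0^'+] --> (0 : R).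
  by rewrite -[X in _ --> X]t0; apply: cvg_at_right_filter; exact: ct.
have tLF : t x @[x --> L^'-] --> (0 : R).
  by rewrite -[X in _ --> X]tL; apply: cvg_at_left_filter; exact: ct.
have := ac_integration_by_parts L0 (fun x _ => dt x) mt1 dB mB' acv dv
  dirichlet_integrable (cvg0_mul_mbounded2 _ (at_right_itv L0) mbv mt1N t0F u0)
  (cvg0_mul_mbounded2 _ (at_left_itv L0) mbv mt1N tLF uL).
rewrite (_ : \int[mu]_(x in _) _
  = \int[mu]_(x in `]0, L[) (q x * u x - t x * f x)); last first.
  by apply: eq_Rintegral => x _; ring.
rewrite (RintegralB _ int2 int1)// subr0 => E0.
by apply/eqP; rewrite -subr_eq0 E0.
Qed.

(* The test function is y u / r with r = sqrt (u^2 + e^2), so that the boundary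
   terms are those of y (r - e), an approximation of y |u|. *)
Lemma dirichlet_L1_bound (y y1 : R -> R) :
  0 <= k ->
  (forall x : R, is_derive x 1 y (y1 x)) ->
  (forall x : R, is_derive x 1 y1 (k * y x - 1)) ->
  y 0 = 0 -> y L = 0 -> (forall x : R, x \in `]0, L[ -> 0 <= y x) ->
  \int[mu]_(x in `]0, L[) `|u x| <= \int[mu]_(x in `]0, L[) (y x * `|f x|).
Proof.
move=> k0 dy dy1 y0 yL yge0.
have mbc (g : R -> R) : continuous g -> mbounded 0 L g.
  by move=> cg; apply: mbounded_continuous => //; exact: ltW.
have cy : continuous y by move=> x; exact: is_derive_continuous (dy x).
have cy1 : continuous y1 by move=> x; exact: is_derive_continuous (dy1 x).
have [mby mby1] : mbounded 0 L y /\ mbounded 0 L y1 by split; exact: mbc.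
have mbu := dirichlet_mbounded; have mbv := abs_continuous_mbounded acv.
have inty := mboundedM_integrable mby (integrable_norm intf).
have intu := integrable_norm (mbounded_integrable mbu).
(* Smoothing costs at most [e] at each point, hence [e * L] in all; [approx] is used with
   [e / L]. *)
suff approx (e : R) : 0 < e ->
    \int[mu]_(x in `]0, L[) `|u x| <= \int[mu]_(x in `]0, L[) (y x * `|f x|) + e * L.
  apply/ler_addgt0Pr => e e0.
  by rewrite -(divfK (lt0r_neq0 L0) e) approx// divr_gt0.
move=> e0.
(* The term e^2 keeps the root [r] differentiable at the zeros of [u]. *)
pose g (x : R) := u x * u x + e * e.
pose r (x : R) := Num.sqrt (g x).
have g0 x : 0 < g x by rewrite ltr_wpDl// ?mulr_gt0// -expr2 sqr_ge0.
have r0 x : 0 < r x by rewrite sqrtr_gt0.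
have rr x : r x * r x = u x * u x + e * e by rewrite -expr2 sqr_sqrtr// ltW.
have er x : e <= r x.
  rewrite -[leLHS]gtr0_norm// -sqrtr_sqr ler_wsqrtr// expr2 lerDr.
  by rewrite -expr2 sqr_ge0.
have ru x : `|u x| <= r x.
  by rewrite -sqrtr_sqr ler_wsqrtr// expr2 lerDl mulr_ge0// ltW.
pose ri (x : R) := (r x)^-1.
have rri x : r x * ri x = 1 by rewrite divff// gt_eqF.
have ri0 x : 0 < ri x by rewrite invr_gt0.
have dg x : x \in `]0, L[ -> is_derive x 1 g (v x * u x + u x * v x + 0).
  move=> xL; have h := is_derive1M (du xL) (du xL).
  exact (is_deriveD h (is_derive_cst (e * e) x 1)).
have dr x (xL : x \in `]0, L[) := (is_derive_inv_sqrt (g0 x) (dg x xL)).1.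
have dri x (xL : x \in `]0, L[) := (is_derive_inv_sqrt (g0 x) (dg x xL)).2.
have mbri : mbounded 0 L ri.
  split; first exact: derivable_measurable dri.
  exists e^-1 => x _; rewrite gtr0_norm//.
  by rewrite /ri lef_pV2 ?posrE.
have mbvu : mbounded 0 L (fun x => (v x * u x + u x * v x + 0) / 2).
  apply: mboundedM; last exact: mbounded_cst.
  by apply: mboundedD; [apply: mboundedD; exact: mboundedM|exact: mbounded_cst].
have mbr' := mboundedM mbvu mbri.
have mbr : mbounded 0 L r.
  by have [_ [K r'K]] := mbr'; exact (bounded_derivative_mbounded dr r'K).
pose ri' (x : R) := - ((v x * u x + u x * v x + 0) / 2) * ri x ^+ 3.
have mbri' : mbounded 0 L ri'.
  apply: mboundedM; first exact: mboundedN.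
  by do 2 apply: mboundedM => //.
pose A (x : R) := y x * (u x * ri x).
pose A' (x : R) := y1 x * (u x * ri x) + y x * (v x * ri x + u x * ri' x).
have dA x : x \in `]0, L[ -> is_derive x 1 A (A' x).
  by move=> xL; exact (is_derive1M (dy x) (is_derive1M (du xL) (dri x xL))).
have mbA' : mbounded 0 L A'.
  apply: mboundedD; first by do 2 apply: mboundedM => //.
  by apply: mboundedM => //; apply: mboundedD; exact: mboundedM.
(* As r' = u v / r, the sum [A v + B] is y (r - e)' - y' (r - e), the Wronskian of [y] and
   [r - e]. *)
pose B (x : R) := (r x - e) * - y1 x.
pose r' (x : R) := (v x * u x + u x * v x + 0) / 2 * ri x.
pose B' (x : R) := (r' x - 0) * - y1 x + (r x - e) * - (k * y x - 1).
have dB x : x \in `]0, L[ -> is_derive x 1 B (B' x).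
  move=> xL; have h := is_deriveB (dr x xL) (is_derive_cst e x 1).
  exact (is_derive1M h (is_deriveN (dy1 x))).
have mbB' : mbounded 0 L B'.
  apply: mboundedD; apply: mboundedM.
  - by apply: mboundedB => //; exact: mbounded_cst.
  - exact: mboundedN.
  - by apply: mboundedB => //; exact: mbounded_cst.
  - apply: mboundedN; apply: mboundedB; last exact: mbounded_cst.
    by apply: mboundedM => //; exact: mbounded_cst.
have rF (F : set_system R) : Filter F -> u x @[x --> F] --> (0 : R) ->
    r x - e @[x --> F] --> (0 : R).
  move=> FF uF; rewrite -(subrr e); apply: cvgB; last exact: cvg_cst.
  have -> : e = Num.sqrt (0 * 0 + e * e).
    by rewrite mul0r add0r -expr2 sqrtr_sqr gtr0_norm.
  apply: continuous_cvg; first exact: sqrt_continuous.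
  by apply: cvgD; [exact: cvgM|exact: cvg_cst].
have mbh : mbounded 0 L (fun x => u x * ri x * v x) by do 2 apply: mboundedM => //.
have my1N := mboundedN mby1.
(* In this grouping each product has a factor, [y] or [r - e], that tends to 0 and a bounded one. *)
have AB x : y x * (u x * ri x * v x) + (r x - e) * - y1 x = A x * v x + B x.
  by rewrite /A /B mulrA.
have A0 : A x * v x + B x @[x --> 0^'+] --> (0 : R).
  under eq_fun do rewrite -AB.
  apply: cvg0_mul_mbounded2 (at_right_itv L0) mbh my1N _ (rF _ _ u0).
  by rewrite -[X in _ --> X]y0; apply: cvg_at_right_filter; exact: cy.
have AL : A x * v x + B x @[x --> L^'-] --> (0 : R).
  under eq_fun do rewrite -AB.
  apply: cvg0_mul_mbounded2 (at_left_itv L0) mbh my1N _ (rF _ _ uL).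
  by rewrite -[X in _ --> X]yL; apply: cvg_at_left_filter; exact: cy.
pose G (x : R) := A x * (k * u x - f x) + (A' x * v x + B' x).
have G0 : \int[mu]_(x in `]0, L[) G x = 0.
  rewrite -[RHS](subr0 0).
  exact: (ac_integration_by_parts L0 dA mbA' dB mbB' acv dv dirichlet_integrable A0 AL).
have mbA : mbounded 0 L A by do 2 apply: mboundedM => //.
have intG : mu.-integrable `]0, L[ (EFin \o G).
  apply: integrable_EFinD => //.
    exact: mboundedM_integrable mbA dirichlet_integrable.
  by apply: mbounded_integrable; apply: mboundedD => //; exact: mboundedM.
have inte : mu.-integrable `]0, L[ (EFin \o (fun=> e)).
  exact: mbounded_integrable (mbounded_cst _ _ e).
(* [tau] is the smoothed sign of [u]. The term in v^2 is nonnegative by convexity of the smoothed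
   modulus, and tau u = r - e^2 / r >= r - e takes care of the terms with [k]; what remains is at
   least r - e - y |f|. *)
have le_G x : x \in `]0, L[ -> `|u x| - y x * `|f x| <= G x + e.
  move=> xL; have yx := yge0 x xL.
  set tau := u x * ri x.
  have GE : G x = y x * (tau * (k * u x - f x))
    + y x * (v x * v x) * ri x * (1 - tau * tau) - (k * y x - 1) * (r x - e).
    by rewrite /G /A /A' /B' /r' /ri' /tau; field.
  have tau1 : `|tau| <= 1.
    by rewrite normrM (gtr0_norm (ri0 x)) ler_pdivrMr// mul1r.
  have tauf : tau * f x <= `|f x|.
    by rewrite (le_trans (ler_norm _))// normrM ler_piMl.
  have tau2 : 0 <= 1 - tau * tau.
    by rewrite subr_ge0 -expr2 -real_normK ?num_real// expr_le1.
  have tauu : r x - e <= tau * u x.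
    have -> : tau * u x = (u x * u x) * ri x by rewrite /tau; ring.
    have -> : u x * u x = r x * r x - e * e by rewrite rr addrK.
    rewrite mulrBl -mulrA -(mulrA e).
    rewrite rri mulr1 lerD2l lerN2 ler_piMr ?(ltW e0)//.
    by rewrite ler_pdivrMr// mul1r.
  have h1 : 0 <= y x * (v x * v x) * ri x * (1 - tau * tau).
    have vv : 0 <= v x * v x by rewrite -expr2 sqr_ge0.
    by rewrite mulr_ge0// mulr_ge0 ?(ltW (ri0 x))// mulr_ge0.
  have h2 := ler_wpM2l (mulr_ge0 k0 yx) tauu.
  have h3 := ler_wpM2l yx tauf.
  have h4 := ru x.
  rewrite GE; nra.
have [inty' intu'] : mu.-integrable `]0, L[ (EFin \o (fun x => y x * `|f x|))
  /\ mu.-integrable `]0, L[ (EFin \o (fun x => `|u x|)) by [].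
rewrite -lerBlDl -RintegralB//.
have -> : e * L = \int[mu]_(x in `]0, L[) (G x + e).
  rewrite RintegralD// G0 add0r Rintegral_cst//= lebesgue_measure_itv/= lte_fin L0.
  by rewrite -EFinB subr0.
apply: le_Rintegral => //; [exact: integrable_EFinB|exact: integrable_EFinD].
Qed.

End dirichlet.

(** * The a priori bounds *)

(** The endpoints form a null set. This passes from the norms, taken on the closed interval, to the
    open interval where the derivatives of [w] are controlled. *)
Lemma Rintegral_itv_cc_oo (R : realType) (a b : R) (f : R -> R) :
  measurable_fun `]a, b[ f ->
  \int[@lebesgue_measure R]_(x in `[a, b]) f x =
  \int[@lebesgue_measure R]_(x in `]a, b[) f x.
Proof.
move=> mf; rewrite /Rintegral (@integral_itv_bndoo R a b _ true false)//.
exact/measurable_EFinP.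
Qed.

Lemma powR52 (R : realType) (a : R) : 0 < a -> a `^ (5 / 2) = a ^+ 2 * Num.sqrt a.
Proof.
move=> a0; rewrite (_ : 5 / 2 = 2%:R + 2^-1); last by field.
rewrite powRD; last by rewrite gt_eqF// implybT.
by rewrite powR_mulrn ?ltW// powR12_sqrt// ltW.
Qed.

Lemma Rintegral_parabola (R : realType) (L : R) : 0 < L ->
  \int[@lebesgue_measure R]_(x in `]0, L[) (x * (L - x) / 2) = L ^+ 3 / 12.
Proof.
move=> L0.
pose H : R -> R := (L / 4) \*: (id * id) - 6^-1 \*: (id * (id * id)).
have dH (x : R) : is_derive x 1 H (x * (L - x) / 2).
  by apply: is_derive_eq; rewrite /GRing.scale/= -[(id * id) x]/(x * x); field.
have cq : continuous (fun x : R => x * (L - x) / 2).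
  move=> x; apply: cvgM; last exact: cvg_cst.
  by apply: cvgM; [exact: cvg_id|apply: cvgB; [exact: cvg_cst|exact: cvg_id]].
rewrite (Rintegral_oo_FTC L0 dH cq).
rewrite -[H L]/(L / 4 * (L * L) - 6^-1 * (L * (L * L))).
by rewrite -[H 0]/(L / 4 * (0 * 0) - 6^-1 * (0 * (0 * 0))); field.
Qed.

(** Integrating y'' = k y - 1 gives the integral of [y] from the slopes at the ends. *)
Lemma torsion_integral (R : realType) (L k : R) (y y1 : R -> R) :
  0 < L -> 0 < k ->
  (forall x : R, is_derive x 1 y (y1 x)) ->
  (forall x : R, is_derive x 1 y1 (k * y x - 1)) ->
  \int[@lebesgue_measure R]_(x in `]0, L[) y x = (L + (y1 L - y1 0)) / k.
Proof.
move=> L0 k0 dy dy1.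
have cy : continuous y by move=> x; exact: is_derive_continuous (dy x).
have my : mbounded 0 L y by apply: mbounded_continuous => //; exact: ltW.
have ch : continuous (fun x => k * y x - 1).
  move=> x; apply: cvgB; last exact: cvg_cst.
  by apply: cvgM; [exact: cvg_cst|exact: cy].
rewrite -(Rintegral_oo_FTC L0 dy1 ch).
have iky := mbounded_integrable (mboundedM (mbounded_cst 0 L k) my).
have i1 := mbounded_integrable (mbounded_cst 0 L (1 : R)).
rewrite (RintegralB _ iky i1)// RintegralZl//; last exact: mbounded_integrable.
rewrite Rintegral_cst//= lebesgue_measure_itv/= lte_fin L0 -EFinB/=.
by field; rewrite gt_eqF.
Qed.

Lemma derive1n_is_derive (R : realType) (w : R -> R) n (x : R) :
  derivable (derive1n n w) x 1 -> is_derive x 1 (derive1n n w) (derive1n n.+1 w x).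
Proof. by move=> /derivableP; rewrite derive1nS derive1E. Qed.

(* P, U, V are the norms of p, w'' and phi; Y and Z are the integrals of the
   torsion functions y_k and y_a. *)
Lemma apriori_arith (R : realType) (L a b c M N S P U V Y Z k : R) :
  0 < L -> 0 < a -> 0 < b -> 0 < c -> k = a + b * S -> 0 <= S -> 0 <= P -> 0 <= U ->
  a * M = a + c * (L ^+ 3 / 12 - Z) -> N = M + c * L ^+ 2 / 8 * Z ->
  0 <= Y -> Y <= Z -> Z <= L ^+ 3 / 12 ->
  S * (k + c * (L ^+ 3 / 12 - Y)) <= L ^+ 2 / 8 * P ->
  U <= c * S * Y + P / k -> V <= P + b * S * U ->
  P < 2 * a ^+ 2 * M ^+ 2 / (b * L ^+ 2 * N) ->
  [/\ S <= L ^+ 2 / (8 * a * M) * P, U <= N / (a * M) * P & V <= 5 / 4 * P].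
Proof.
move=> L0 a0 b0 c0 kE S0 P0 U0 aME NE Y0 YZ ZL SB UB VB small.
have aM0 : 0 < a * M by rewrite aME ltr_wpDr// mulr_ge0 ?subr_ge0// ltW.
have M0 : 0 < M by rewrite -(pmulr_rgt0 _ a0).
have L2 : 0 < L ^+ 2 by rewrite exprn_gt0.
have Z0 : 0 <= Z by exact: le_trans YZ.
have N0 : 0 < N.
  by rewrite NE ltr_pwDl// mulr_ge0// divr_ge0// mulr_ge0// ltW.
have ak : a <= k by rewrite kE lerDl mulr_ge0// ltW.
(* Replacing [k] by [a] and [Y] by [Z] can only decrease the right side. *)
have aMk : a * M <= k + c * (L ^+ 3 / 12 - Y).
  by rewrite aME lerD// ler_wpM2l ?(ltW c0)// lerB.
have SB1 : S <= L ^+ 2 / (8 * a * M) * P.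
  have -> : L ^+ 2 / (8 * a * M) * P = L ^+ 2 / 8 * P / (a * M).
    by field; rewrite !gt_eqF.
  by rewrite ler_pdivlMr//; apply: le_trans SB; exact: ler_wpM2l.
have UB1 : U <= N / (a * M) * P.
  apply: (le_trans UB).
  have h1 : c * S * Y <= c * (L ^+ 2 / (8 * a * M) * P) * Z.
    rewrite ler_pM ?mulr_ge0 ?(ltW c0)//; exact: ler_wpM2l (ltW c0) _ _ SB1.
  have h2 : P / k <= P / a.
    by rewrite ler_wpM2l// lef_pV2 ?posrE// (lt_le_trans a0).
  (* This is N = M + c L^2 Z / 8 multiplied by P / (a M). *)
  have -> : N / (a * M) * P = c * (L ^+ 2 / (8 * a * M) * P) * Z + P / a.
    by rewrite NE; field; rewrite !gt_eqF.
  exact: lerD.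
split=> //; apply: (le_trans VB).
(* The first two bounds give b S U <= b L^2 N P^2 / (8 a^2 M^2); smallness of [P] bounds b L^2 N P
   by 2 a^2 M^2, which leaves P / 4. *)
have h : b * S * U <= b * (L ^+ 2 / (8 * a * M) * P) * (N / (a * M) * P).
  by rewrite ler_pM ?mulr_ge0 ?(ltW b0)// ler_wpM2l// ltW.
have h' : b * L ^+ 2 * N * P <= 2 * a ^+ 2 * M ^+ 2.
  by rewrite mulrC -ler_pdivlMr ?mulr_gt0// ltW.
have -> : 5 / 4 * P = P + P / 4 by field.
rewrite lerD2l; apply: (le_trans h).
have -> : b * (L ^+ 2 / (8 * a * M) * P) * (N / (a * M) * P) =
    (b * L ^+ 2 * N * P) / (8 * a ^+ 2 * M ^+ 2) * P.
  by field; rewrite !gt_eqF.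
rewrite mulrC ler_wpM2l// ler_pdivrMr ?mulr_gt0 ?exprn_gt0//.
by apply: (le_trans h'); rewrite le_eqVlt; apply/orP; left; apply/eqP; field.
Qed.

Unset Implicit Arguments.

Theorem lemma3p1 (R : realType) (L a b c : R) (p w : R -> R)
  (hL : 0 < L) (ha : 0 < a) (hb : 0 < b) (hc : 0 < c)
  (hp : in_L1 L p)
  (hpsmall : 2 * a ^+ 2 * constM L a c ^+ 2 / (b * L ^+ 2 * constN L a c)
             > norm1 L p)
  (hw : in_W41 L w)
  (hsol : is_solution L a b c p w)
  (hpos : 0 <= integral0L L w) :
  [/\ `|integral0L L w| <= L ^+ 2 / (8 * a * constM L a c) * norm1 L p,
      norm1 L (derive1n 2 w) <= constN L a c / (a * constM L a c) * norm1 L p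
    & norm1 L (fun x => p x + b * integral0L L w * derive1n 2 w x)
        <= 5 / 4 * norm1 L p].
Proof.

(* Reduction to a Dirichlet problem for w'' *)
have [cw dw acv dv _] := hw; have [eq_w w0 wL u0 uL] := hsol.
set S := integral0L L w in eq_w hpos *; rewrite (ger0_norm hpos).
pose k := a + b * S.
have k0 : 0 < k by rewrite ltr_wpDr// mulr_ge0// ltW.
pose u : R -> R := derive1n 2 w; pose v : R -> R := derive1n 3 w.
pose w1 : R -> R := derive1n 1 w.
have dwx (x : R) : x \in `]0, L[ -> is_derive x 1 w (w1 x).
  by move=> xL; exact (@derive1n_is_derive R w 0 x (dw 0 x isT xL)).
have dw1 (x : R) : x \in `]0, L[ -> is_derive x 1 w1 (u x).
  by move=> xL; exact (@derive1n_is_derive R w 1 x (dw 1 x isT xL)).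
have du (x : R) : x \in `]0, L[ -> is_derive x 1 u (v x).
  by move=> xL; exact (@derive1n_is_derive R w 2 x (dw 2 x isT xL)).
(* The equation for [w] becomes v' = k u - f with this [f]. *)
pose f (x : R) := c * S - p x.
have {}dv : {ae @lebesgue_measure R, forall x : R, x \in `]0, L[ ->
    is_derive x 1 v (k * u x - f x)}.
  have := eq_w; have := dv; apply: filterS2.
    exact: (ae_filter_ringOfSetsType lebesgue_measure).
  move=> x dvx eqx xL; have dvx4 := @derive1n_is_derive R w 3 x (dvx xL).
  apply: is_derive_eq dvx4 _.
  by rewrite /f -(eqx xL) /k /u; move: (derive1n 4 w x) => ?; ring.
have mL : measurable `]0, L[ by exact: measurable_itv.
have ip : (@lebesgue_measure R).-integrable `]0, L[ (EFin \o p).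
  by apply: integrableS hp => //; exact: subset_itv_oo_cc.
have mp : measurable_fun `]0, L[ p by move/integrableP : ip => [/measurable_EFinP].
have intf : (@lebesgue_measure R).-integrable `]0, L[ (EFin \o f).
  exact: integrable_EFinB (mbounded_integrable (mbounded_cst 0 L (c * S))) ip.
(* Boundedness passes down from w''' to w'', w' and [w], each having the previous one as its
   derivative. *)
have mbv := abs_continuous_mbounded acv.
have mbu := dirichlet_mbounded du acv.
have mbw1 : mbounded 0 L w1.
  by have [_ [K uK]] := mbu; exact (bounded_derivative_mbounded dw1 uK).
have acw1 : abs_continuous_on `]0, L[ w1.
  by have [_ [K uK]] := mbu; exact (bounded_derivative_abs_continuous dw1 uK).
have mbw := dirichlet_mbounded dwx acw1.
have w_0 : w x @[x --> 0^'+] --> (0 : R).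
  by rewrite -[X in _ --> X]w0; have /(continuous_within_itvP w hL)[] := cw.
have w_L : w x @[x --> L^'-] --> (0 : R).
  by rewrite -[X in _ --> X]wL; have /(continuous_within_itvP w hL)[] := cw.

(* Torsion functions, the parabola and theta *)
have [y [y1 [dyy1 y0 yL yb _]]] := torsion_function hL k0.
(* This one belongs to [a]; its end slopes [zz] bring in the hyperbolic tangent of [M] and [N]. *)
have [z [z1 [dzz1 z0 zL zb zz]]] := torsion_function hL ha.
have dy x := (dyy1 x).1; have dy1 x := (dyy1 x).2.
have dz x := (dzz1 x).1; have dz1 x := (dzz1 x).2.
have mbc (g : R -> R) : continuous g -> mbounded 0 L g.
  by move=> cg; apply: mbounded_continuous => //; exact: ltW.
have cy : continuous y by move=> x; exact: is_derive_continuous (dy x).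
have cz : continuous z by move=> x; exact: is_derive_continuous (dz x).
have mby := mbc _ cy; have mbz := mbc _ cz.
pose q (x : R) := x * (L - x) / 2.
pose q1 (x : R) := L / 2 - x.
have dq (x : R) : is_derive x 1 q (q1 x).
  have h := is_derive1M (is_derive1M (is_derive_id x 1)
    (is_deriveB (is_derive_cst L x 1) (is_derive_id x 1)))
    (is_derive_cst (2^-1 : R) x 1).
  by apply: is_derive_eq h _; rewrite /q1 /= -[(cst L - id) x]/(L - x); field.
have dq1 (x : R) : is_derive x 1 q1 (- 1).
  apply: is_derive_eq (is_deriveB (is_derive_cst (L / 2) x 1) (is_derive_id x 1)) _.
  by rewrite sub0r.
have cq : continuous q by move=> x; exact: is_derive_continuous (dq x).
have mbq := mbc _ cq.
have q0 : q 0 = 0 by rewrite /q !mul0r.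
have qL : q L = 0 by rewrite /q subrr mulr0 mul0r.
(* This is theta; its second derivative is - y, which equals k t - q. *)
pose t (x : R) := k^-1 * (q x - y x).
pose t1 (x : R) := k^-1 * (q1 x - y1 x).
have dt (x : R) : is_derive x 1 t (t1 x).
  apply: is_derive_eq (is_derive1M (is_derive_cst (k^-1 : R) x 1)
    (is_deriveB (dq x) (dy x))) _.
  by rewrite mul0r add0r.
have dt1 (x : R) : is_derive x 1 t1 (k * t x - q x).
  apply: is_derive_eq (is_derive1M (is_derive_cst (k^-1 : R) x 1)
    (is_deriveB (dq1 x) (dy1 x))) _.
  by rewrite mul0r add0r /t /=; field; rewrite gt_eqF.
have ct : continuous t by move=> x; exact: is_derive_continuous (dt x).
have mbt := mbc _ ct.
have itvE x : x \in `]0, L[ -> 0 < x < L by rewrite in_itv.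

(* Integral identities and comparison of the torsion functions *)
pose I (g : R -> R) := \int[@lebesgue_measure R]_(x in `]0, L[) g x.
have I1 r : I (fun=> r) = r * L.
  by rewrite /I Rintegral_cst//= lebesgue_measure_itv/= lte_fin hL -EFinB subr0.
have Iq : I q = L ^+ 3 / 12 by exact: Rintegral_parabola.
have SE : S = I w by exact: Rintegral_itv_cc_oo mbw.1.
have PE : norm1 L p = I (fun x => `|p x|).
  by apply: Rintegral_itv_cc_oo; exact: measurableT_comp.
have UE : norm1 L u = I (fun x => `|u x|).
  by apply: Rintegral_itv_cc_oo; apply: measurableT_comp => //; case: mbu.
have iabsp := integrable_norm ip.
have iabsu := integrable_norm (mbounded_integrable mbu).
(* Duality with coefficient 0: - w'' = - u and - q'' = 1. *)
have Sq : S = - I (fun x => q x * u x).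
  have dw1' : {ae @lebesgue_measure R, forall x : R, x \in `]0, L[ ->
      is_derive x 1 w1 (0 * w x - - u x)}.
    by apply: aeW => x /dw1; rewrite mul0r sub0r opprK.
  have dq1' (x : R) : is_derive x 1 q1 (0 * q x - 1).
    by rewrite mul0r sub0r; exact: dq1.
  have := dirichlet_duality hL dwx acw1 dw1' (mbounded_integrable (mboundedN mbu))
    w_0 w_L dq dq1' (fun x => cvg_cst _) q0 qL.
  under eq_Rintegral do rewrite mul1r; rewrite -/(I w) -SE => ->.
  under eq_Rintegral do rewrite mulrN -mulN1r.
  rewrite RintegralZl ?mulN1r//.
  exact: mbounded_integrable (mboundedM mbq mbu).
have qu : I (fun x => q x * u x) = I (fun x => t x * f x).
  apply: (dirichlet_duality hL du acv dv intf u0 uL dt dt1 cq).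
    by rewrite /t q0 y0 subrr mulr0.
  by rewrite /t qL yL subrr mulr0.
(* The difference is (k - a) times the integral of y z. *)
have YZ : I y <= I z.
  have [_ [K z2K]] : mbounded 0 L (fun x => a * z x - 1).
    by apply: mboundedB; [apply: mboundedM => //|]; exact: mbounded_cst.
  (* [z] also solves - z'' + k z = g, and g >= 1. Duality with [y] turns the integral of [z] into
     that of y g. *)
  pose g (x : R) := (k - a) * z x + 1.
  have mbg : mbounded 0 L g.
    by apply: mboundedD; [apply: mboundedM => //|]; exact: mbounded_cst.
  have dz1' : {ae @lebesgue_measure R, forall x : R, x \in `]0, L[ ->
      is_derive x 1 z1 (k * z x - g x)}.
    apply: aeW => x _; rewrite (_ : k * z x - g x = a * z x - 1) ?/g; last by ring.
    exact: dz1.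
  have zF0 : z x @[x --> 0^'+] --> (0 : R).
    by rewrite -[X in _ --> X]z0; apply: cvg_at_right_filter; exact: cz.
  have zFL : z x @[x --> L^'-] --> (0 : R).
    by rewrite -[X in _ --> X]zL; apply: cvg_at_left_filter; exact: cz.
  have acz1 := bounded_derivative_abs_continuous (fun x _ => dz1 x) z2K.
  have := dirichlet_duality hL (fun x _ => dz x) acz1 dz1' (mbounded_integrable mbg)
    zF0 zFL dy dy1 (fun x => cvg_cst _) y0 yL.
  under eq_Rintegral do rewrite mul1r; rewrite -/(I z) => ->.
  apply: le_Rintegral => //; first exact: mbounded_integrable.
    exact: mbounded_integrable (mboundedM mby mbg).
  move=> x /itvE x0L; have [z_ge0 _ _] := zb x x0L; have [y_ge0 _ _] := yb x x0L.
  by rewrite ler_peMr// /g lerDr mulr_ge0// /k addrAC subrr add0r mulr_ge0// ltW.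
have ZE : I z = (L - 2 / Num.sqrt a * tanh (Num.sqrt a * L / 2)) / a.
  by rewrite /I (torsion_integral hL ha dz dz1) zz.
have Y0 : 0 <= I y by apply: Rintegral_ge0 => x /itvE/yb[].
have Zq : I z <= L ^+ 3 / 12.
  rewrite -Iq; apply: le_Rintegral => //; try exact: mbounded_integrable.
  by move=> x /itvE/zb[].

(* Estimates for S, w'' and phi *)
have SB : S * (k + c * (L ^+ 3 / 12 - I y)) <= L ^+ 2 / 8 * norm1 L p.
  have iY := mbounded_integrable mby.
  have It : I t = k^-1 * (L ^+ 3 / 12 - I y).
    rewrite /I RintegralZl//; last exact: integrable_EFinB (mbounded_integrable mbq) iY.
    by rewrite RintegralB// ?(mbounded_integrable mbq)// -/(I q) Iq.
  have itp := mboundedM_integrable mbt ip.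
  have Itf : I (fun x => t x * f x) = c * S * I t - I (fun x => t x * p x).
    rewrite /I -RintegralZl//; last exact: mbounded_integrable.
    rewrite -RintegralB//; last first.
      exact: mbounded_integrable (mboundedM (mbounded_cst 0 L (c * S)) mbt).
    by apply: eq_Rintegral => x _; rewrite /f; ring.
  have Itp : I (fun x => t x * p x) <= L ^+ 2 / (8 * k) * norm1 L p.
    rewrite PE /I -RintegralZl//; apply: le_Rintegral => //.
      exact: mboundedM_integrable (mbounded_cst 0 L (L ^+ 2 / (8 * k))) iabsp.
    move=> x /itvE x0L; have [y_ge0 _ yq] := yb x x0L.
    have t_ge0 : 0 <= t x by rewrite mulr_ge0 ?invr_ge0 ?subr_ge0// ltW.
    apply: (@le_trans _ _ (t x * `|p x|)); first by rewrite ler_wpM2l// ler_norm.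
    rewrite ler_wpM2r// /t mulrC ler_pdivrMr//.
    have -> : L ^+ 2 / (8 * k) * k = L ^+ 2 / 8 by field; rewrite gt_eqF.
    apply: (@le_trans _ _ (q x)); first by rewrite gerBl.
    (* The maximum L^2 / 8 of [q] is attained at the midpoint. *)
    by rewrite /q; have := sqr_ge0 (x - L / 2); nra.
  (* Multiplying by [k] clears the inverse in [t]: k times the integral of [t] is L^3 / 12 minus
     that of [y]. *)
  have -> : S * (k + c * (L ^+ 3 / 12 - I y)) = k * (S + c * S * I t).
    by rewrite It; field; rewrite gt_eqF.
  have -> : S + c * S * I t = I (fun x => t x * p x) by rewrite {1}Sq qu Itf; ring.
  apply: (le_trans (ler_wpM2l (ltW k0) Itp)).
  by rewrite le_eqVlt; apply/orP; left; apply/eqP; field; rewrite gt_eqF.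
have UB : norm1 L u <= c * S * I y + norm1 L p / k.
  have yL0 x : x \in `]0, L[ -> 0 <= y x by move=> /itvE/yb[].
  rewrite UE; apply: le_trans (dirichlet_L1_bound hL du acv dv intf u0 uL
    (ltW k0) dy dy1 y0 yL yL0) _.
  have i1 := mbounded_integrable (mboundedM (mbounded_cst 0 L (c * S)) mby).
  have i2 := mboundedM_integrable (mbounded_cst 0 L k^-1) iabsp.
  rewrite (mulrC (norm1 L p)) PE /I -RintegralZl//; last exact: mbounded_integrable.
  rewrite -[X in _ + X]RintegralZl// -RintegralD//; apply: le_Rintegral => //.
  - exact: mboundedM_integrable mby (integrable_norm intf).
  - exact: integrable_EFinD i1 i2.
  move=> x /itvE/yb[y_ge0 yk _].
  have cS : 0 <= c * S by rewrite mulr_ge0// ltW.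
  (* The constant part keeps the weight [y], to be compared with [z] after integration; on |p| the
     weight is bounded by 1 / k. *)
  apply: (@le_trans _ _ (y x * (c * S + `|p x|))).
    by rewrite ler_wpM2l// (le_trans (ler_normB _ _))// ger0_norm.
  by rewrite mulrDr mulrC lerD2l ler_wpM2r.
have VB : norm1 L (fun x => p x + b * S * u x) <= norm1 L p + b * S * norm1 L u.
  have bS : 0 <= b * S by rewrite mulr_ge0// ltW.
  have mbSu := mboundedM (mbounded_cst 0 L (b * S)) mbu.
  have iV := integrable_norm
    (integrable_EFinD mL ip (mbounded_integrable mbSu)).
  rewrite [leLHS]Rintegral_itv_cc_oo; last first.
    apply: measurableT_comp => //; apply: measurable_funD => //; by case: mbSu.
  have i2 := mboundedM_integrable (mbounded_cst 0 L (b * S)) iabsu.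
  rewrite UE PE /I -RintegralZl// -RintegralD//; apply: le_Rintegral => //.
    exact: integrable_EFinD iabsp i2.
  by move=> x _; rewrite (le_trans (ler_normD _ _))// lerD2l normrM ger0_norm.
have sa0 : Num.sqrt a != 0 by rewrite gt_eqF// sqrtr_gt0.
have a0 : a != 0 by rewrite gt_eqF.
apply: (@apriori_arith R L a b c _ _ S _ _ _ (I y) (I z) k) => //.
- by rewrite PE; exact: Rintegral_ge0.
- by rewrite -/u UE; exact: Rintegral_ge0.
- by rewrite /constM ZE powR52//; field; rewrite a0 sa0.
(* The coefficient 5/24 in [constN] is 1/12 from [constM] plus 1/8 from c L^2 Z / 8. *)
- by rewrite /constM /constN ZE powR52//; field; rewrite a0 sa0.
Qed.
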